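(* Let $k\ge2$ be an integer and let $\mu$ be a Borel probability measure on $[-1,1]$ with density $\frac{d\mu}{dx}(t)=\frac{g(t)}{\pi\sqrt{1-t^2}}$, where $g$ is non-negative, concave and increasing on $(-1,1)$ and $t\mapsto\frac{g(t)}{t+1}$ is convex on $(-1,1)$. Put $W_g(x)=k\int_{-1}^x d\mu(t)$ for $x\in[-1,1]$, so that $W_g'(t)=\frac{k\,g(t)}{\pi\sqrt{1-t^2}}$. Then for all distinct $x,t\in[-1,1]$ $$c_1\,W_g'\Bigl(\frac{t+x}2\Bigr)\le\frac{W_g(t)-W_g(x)}{t-x}\le c_2\,W_g'\Bigl(\frac{t+x}2\Bigr),$$ where $c_1=\frac14$ and $c_2=\pi\sqrt2$.
   Context: ''Increasing'' is meant in the non-strict sense. *)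

(* Defs.v *)
From mathcomp Require Export all_boot all_order all_algebra.
From mathcomp Require Export all_classical all_reals all_analysis.

Set Implicit Arguments.
Unset Strict Implicit.
Unset Printing Implicit Defensive.

Export Order.TTheory GRing.Theory Num.Theory.
Export numFieldNormedType.Exports.

Local Open Scope classical_set_scope.
Local Open Scope ring_scope.

(* [measurableTypeR R] is the real line with its Borel sigma-algebra. *)

(* [mu] is a probability measure on the Borel sets of R, concentrated on D:
   this is how a Borel probability measure on D is represented. *)
Definition concentrated_on (R : realType)
    (mu : probability (measurableTypeR R) R) (D : set R) : Prop :=
  mu D = 1%:E.

Definition has_density_on (R : realType)
    (mu : probability (measurableTypeR R) R) (D : set R) (f : R -> R) : Prop :=
  forall A : set (measurableTypeR R), measurable A -> A `<=` D ->
    mu A = (\int[@lebesgue_measure R]_(t in A) (f t)%:E)%E.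

Definition concave_function (R : realType) (D : set R) (f : R -> R) : Prop :=
  @convex_function R R^o D (fun t => - f t).

(* At t = -1 and t = 1 the quotient is a division by zero (equal to 0); these
   two points are Lebesgue-null, so this does not affect [has_density_on]. *)
Definition weighted_arcsine (R : realType) (g : R -> R) (t : R) : R :=
  g t / (pi * Num.sqrt (1 - t ^+ 2)).

Definition W (R : realType) (k : nat)
    (mu : probability (measurableTypeR R) R) (x : R) : R :=
  k%:R * (\int[mu]_(t in `[-1, x]) 1)%R.

(* Main.v *)
Require Import Defs.
From mathcomp Require Import measurable_realfun ring lra.

(** Concavity and non-negativity make [g s / (1 + s)] decreasing on (-1, 1), so
    [g] is squeezed between a constant and a line, hence continuous, and
    [W' = k f] with [f s = g s / (pi * sqrt ((1 - s) * (1 + s)))].  Let [m] be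
    the midpoint of [x, t] and [h = (t - x) / 2 <= min (1 + m) (1 - m)].
    On [m, t], [g s <= g m * (1 + s) / (1 + m)] and [1 + s <= 2 * (1 + m)]
    bound [f s] by a multiple of [1 / sqrt (1 - s)], whose primitive gives
    [2 * sqrt 2 * h * f m]; on [x, m], [g s <= g m] likewise gives
    [2 * h * f m]; and [1 + sqrt 2 <= 2 * sqrt 2 <= pi * sqrt 2].
    From below, [f s >= f m / sqrt 2] on [m, t] and [f >= 0] on [x, m]. *)

Local Open Scope classical_set_scope.
Local Open Scope ring_scope.

(** * Comparison of increments, and a ratio inequality for concave functions *)

(** Derivatives are compared only inside the interval, with continuity up to its ends, because the
    primitives used below may fail to be differentiable at -1 and 1. *)
Lemma increment_le (R : realType) (F G dF dG : R -> R) (a b : R) : a <= b ->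
    {within `[a, b], continuous F} -> {within `[a, b], continuous G} ->
    (forall s, a < s -> s < b ->
      [/\ is_derive s 1 F (dF s), is_derive s 1 G (dG s) & dF s <= dG s]) ->
  F b - F a <= G b - G a.
Proof.
move=> ab cF cG dFG.
suff : (G - F) a <= (G - F) b by rewrite !fctE; lra.
apply: (@ger0_derive1_le_cc _ (G - F) a b) => //.
- by move=> s; rewrite in_itv => /andP[as_ sb]; have [? ? _] := dFG s as_ sb.
- move=> s; rewrite in_itv => /andP[as_ sb]; have [? ? dle] := dFG s as_ sb.
  by rewrite derive1E derive_val subr_ge0.
- by move=> s; apply: cvgB; [exact: cG|exact: cF].
- by rewrite in_itv /= lexx.
- by rewrite in_itv /= lexx andbT.
Qed.

(** For [a < r < x], the value [g x] lies above the chord from [r] to [y]; dropping the term in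
    [g r >= 0] gives the claim with [r] in place of [a]. As [a] lies outside the domain, it is
    reached as a limit. *)
Lemma concave_ge0_ratio_nonincr (R : realType) (g : R -> R) (a b : R)
    (g_ge0 : {in `]a, b[, forall t : R, 0 <= g t})
    (g_concave : concave_function `]a, b[ g) (x y : R) :
  a < x -> x <= y -> y < b -> g y * (x - a) <= g x * (y - a).
Proof.
move=> ax; rewrite le_eqVlt => /predU1P[->//|xy yb].
have chord r : a < r -> r < x -> g y * (x - r) <= g x * (y - r).
  move=> ar rx; have yr : 0 < y - r by lra.
  (* This quotient is the weight of [r] when [x] is written as a convex combination of [r] and
     [y]. *)
  have p0 : 0 <= (y - x) / (y - r) by apply: divr_ge0; lra.
  have p1 : (y - x) / (y - r) <= 1 by rewrite ler_pdivrMr //; lra.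
  have rI : r \in `]a, b[%classic.
    by rewrite inE /= in_itv /=; apply/andP; split; lra.
  have yI : y \in `]a, b[%classic.
    by rewrite inE /= in_itv /=; apply/andP; split; lra.
  have : - g ((y - x) / (y - r) * r + (1 - (y - x) / (y - r)) * y) <=
      (y - x) / (y - r) * - g r + (1 - (y - x) / (y - r)) * - g y.
    exact: g_concave (Itv01 p0 p1) r y rI yI.
  have -> : (y - x) / (y - r) * r + (1 - (y - x) / (y - r)) * y = x.
    by field; lra.
  have gr : 0 <= g r by apply: g_ge0; rewrite in_itv /=; apply/andP; split; lra.
  have -> : (y - x) / (y - r) * - g r + (1 - (y - x) / (y - r)) * - g y =
     - (((y - x) * g r + (x - r) * g y) / (y - r)) by field; lra.
  rewrite lerN2 ler_pdivrMr // => h.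
  have : 0 <= (y - x) * g r by apply: mulr_ge0; lra.
  lra.
(* Pass to the limit [r -> a] in [chord]. *)
apply/ler_addgt0Pr => e e0.
set d := Num.min ((x - a) / 2) (e / (`|g x - g y| + 1)).
have n0 : 0 < `|g x - g y| + 1 by rewrite ltr_wpDl.
have d0 : 0 < d by rewrite lt_min divr_gt0 ?divr_gt0 //; lra.
have dx : d <= (x - a) / 2 by rewrite ge_min lexx.
have de : d * (`|g x - g y| + 1) <= e.
  by rewrite -ler_pdivlMr // ge_min lexx orbT.
have := chord (a + d) ltac:(lra) ltac:(lra).
have := ler_wpM2l (ltW d0) (ler_norm (g y - g x)).
rewrite distrC; lra.
Qed.

(** * Continuity, sign and integrability of the density *)

Section Weighted.
Variables (R : realType) (g : R -> R).
Hypothesis g_ge0 : forall x : R, -1 < x -> x < 1 -> 0 <= g x.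
Hypothesis g_incr : forall x y : R, -1 < x -> x <= y -> y < 1 -> g x <= g y.
Hypothesis g_ratio :
  forall x y : R, -1 < x -> x <= y -> y < 1 -> g y * (1 + x) <= g x * (1 + y).

(** The line [h] takes the value [g x] at [x], and on either side [g s] lies between [g x] and
    [h s], so [g s] is at least as close to [g x] as [h s] is. *)
Lemma monotone_ratio_continuous (x : R) :
  -1 < x -> x < 1 -> {for x, continuous g}.
Proof.
move=> x1 x2; have x0 : 0 < 1 + x by lra.
pose h s := g x * (1 + s) / (1 + x).
have hc : h s @[s --> x] --> g x.
  rewrite (_ : g x = h x); last by rewrite /h; field; lra.
  apply: cvgMl; apply: cvgMr; apply: cvgD; [exact: cvg_cst|exact: cvg_id].
apply/cvgrPdist_lt => e e0; near=> s.
have s1 : -1 < s by near: s; exact: lt_nbhsr.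
have s2 : s < 1 by near: s; exact: lt_nbhsl.
apply: (@le_lt_trans _ _ `|g x - h s|); last first.
  by near: s; move/cvgrPdist_lt : hc; apply.
have [xs|/ltW sx] := leP x s.
  have := g_incr _ _ x1 xs s2; have := g_ratio _ _ x1 xs s2.
  rewrite -ler_pdivlMr // -/(h s) => ? ?.
  by rewrite !ler0_norm; lra.
have := g_incr _ _ s1 sx x2; have := g_ratio _ _ s1 sx x2.
rewrite -ler_pdivrMr // -/(h s) => ? ?.
by rewrite !ger0_norm; lra.
Unshelve. all: by end_near. Qed.

Let f := weighted_arcsine g.

(** Splitting the root separates the singularities at -1 and 1, so that one factor can be bounded
    while the other is integrated. *)
Lemma weighted_arcsineE (s : R) : -1 < s -> s < 1 ->
  f s = g s / (pi * (Num.sqrt (1 - s) * Num.sqrt (1 + s))).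
Proof.
move=> ? ?; rewrite /f /weighted_arcsine -sqrtrM; last lra.
by congr (_ / (_ * Num.sqrt _)); ring.
Qed.

Lemma weighted_arcsine_ge0 (s : R) : -1 <= s -> s <= 1 -> 0 <= f s.
Proof.
rewrite /f /weighted_arcsine => s1 s2.
(* At the end points [1 - s ^+ 2] vanishes and the quotient takes the default value 0. *)
have [[s3 s4]|/eqP s_sqr] : (-1 < s /\ s < 1) \/ 1 - s ^+ 2 == 0.
  by move: s1 s2; rewrite !le_eqVlt => /predU1P[<-|?] /predU1P[->|?];
    [right|right|right|left]; rewrite ?sqrrN ?expr1n ?subrr.
- by apply: divr_ge0; rewrite ?g_ge0 // mulr_ge0 ?pi_ge0.
- by rewrite s_sqr sqrtr0 mulr0 invr0 mulr0.
Qed.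

Lemma weighted_arcsine_continuous (x : R) :
  -1 < x -> x < 1 -> {for x, continuous f}.
Proof.
move=> x1 x2; apply: cvgM; first exact: monotone_ratio_continuous.
apply: cvgV.
  by rewrite mulf_neq0 ?gt_eqF ?pi_gt0 // sqrtr_gt0; nra.
apply: cvgMr; apply: continuous_comp; last exact: sqrt_continuous.
apply: cvgB; first exact: cvg_cst.
exact: exprn_continuous.
Qed.

Lemma weighted_arcsine_measurable : measurable_fun `[-1 : R, 1] f.
Proof.
(* The Booleans select the open interval, where [f] is continuous; adding the end points preserves
   measurability. *)
apply: (@measurable_fun_itv_cc _ _ _ false true).
apply: subspace_continuous_measurable_fun => //.
apply: continuous_in_subspaceT => x; rewrite inE /= in_itv => /andP[? ?].
exact: weighted_arcsine_continuous.
Qed.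

Lemma weighted_arcsine_integrable :
  (\int[@lebesgue_measure R]_(t in `[(-1)%R, 1%R]) (f t)%:E < +oo)%E ->
  (@lebesgue_measure R).-integrable `[-1, 1] (EFin \o f).
Proof.
move=> foo; apply/integrableP; split.
  by apply/measurable_EFinP; exact: weighted_arcsine_measurable.
under eq_integral => t.
  rewrite inE /= in_itv => /andP[? ?]; rewrite ger0_norm ?weighted_arcsine_ge0 //.
  over.
by [].
Qed.

(** * The primitive [V] of the density *)

Hypothesis f_int : (@lebesgue_measure R).-integrable `[-1, 1] (EFin \o f).

Let V (x : R) : R := \int[@lebesgue_measure R]_(t in `[-1, x]) f t.

Lemma integral_weighted_arcsine_derive (x : R) :
  -1 < x -> x < 1 -> is_derive x 1 V (f x).
Proof.
move=> x1 x2; have [dV <-] := continuous_FTC1_closed x2 f_int x1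
  (weighted_arcsine_continuous _ x1 x2).
by rewrite derive1E; exact: derivableP.
Qed.

(** Integrability of [f] suffices, so the ends -1 and 1, where [f] may be unbounded nearby, are
    included. *)
Lemma integral_weighted_arcsine_continuous (a b : R) : -1 <= a -> b <= 1 ->
  {within `[a, b], continuous V}.
Proof.
move=> a1 b1; have := @parameterized_integral_continuous _ (-1) 1 f ltac:(lra) f_int.
apply: continuous_subspaceW => x /=; rewrite !in_itv /=.
by move=> /andP[? ?]; apply/andP; split; lra.
Qed.

(** * Increments of [V] on either side of the midpoint *)

Lemma integral_weighted_arcsine_upper_right (m t : R) :
  -1 < m -> m <= t -> t <= 1 -> t - m <= 1 + m ->
  V t - V m <= 2 * Num.sqrt 2 * ((t - m) * f m).
Proof.
move=> m1 mt t1 tm.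
have [->|t_neqm] := eqVneq t m; first by rewrite !subrr mul0r mulr0.
have m2 : m < 1 by rewrite (lt_le_trans _ t1) // lt_neqAle eq_sym t_neqm.
have pi0 : 0 < pi :> R := pi_gt0 R.
have gm0 := g_ge0 _ m1 m2.
have a0 : 0 < Num.sqrt (1 + m) by rewrite sqrtr_gt0; lra.
have b0 : 0 < Num.sqrt (1 - m) by rewrite sqrtr_gt0; lra.
have a2 : Num.sqrt (1 + m) ^+ 2 = 1 + m by rewrite sqr_sqrtr; lra.
have b2 : Num.sqrt (1 - m) ^+ 2 = 1 - m by rewrite sqr_sqrtr; lra.
(* Chosen so that [A / sqrt (1 - s)], with primitive [G], dominates [f s] on []m, t[]. *)
pose A := Num.sqrt 2 * g m / (pi * Num.sqrt (1 + m)).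
have A0 : 0 <= A by rewrite divr_ge0 ?mulr_ge0 ?sqrtr_ge0 ?pi_ge0.
pose G (s : R) := - (2 * A) * Num.sqrt (1 - s).
have VG : V t - V m <= G t - G m.
  apply: (@increment_le _ V G f (fun s => A / Num.sqrt (1 - s)) m t mt).
  - apply: integral_weighted_arcsine_continuous => //; exact: ltW.
  - apply: continuous_subspaceT => s; apply: cvgMr.
    apply: continuous_comp; last exact: sqrt_continuous.
    by apply: cvgB; [exact: cvg_cst|exact: cvg_id].
  - move=> s ms st; have s1 : -1 < s by lra.
    have s2 : s < 1 by lra.
    have p0 : 0 < Num.sqrt (1 - s) by rewrite sqrtr_gt0; lra.
    have q0 : 0 < Num.sqrt (1 + s) by rewrite sqrtr_gt0; lra.
    have q2 : Num.sqrt (1 + s) ^+ 2 = 1 + s by rewrite sqr_sqrtr; lra.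
    split; first exact: integral_weighted_arcsine_derive.
      have s0 : 0 < 1 - s by lra.
      have ds := is_derive1_sqrt s0.
      apply: is_derive_eq.
      by rewrite /GRing.scale /=; field; rewrite gt_eqF.
    rewrite weighted_arcsineE // /A.
    (* From [t - m <= 1 + m] one gets [1 + s <= 1 + t <= 2 * (1 + m)]. *)
    have qa : Num.sqrt (1 + s) <= Num.sqrt 2 * Num.sqrt (1 + m).
      by rewrite -sqrtrM // ler_sqrt; lra.
    rewrite ler_pdivrMr ?mulr_gt0 //.
    have -> : Num.sqrt 2 * g m / (pi * Num.sqrt (1 + m)) / Num.sqrt (1 - s) *
        (pi * (Num.sqrt (1 - s) * Num.sqrt (1 + s))) =
        g m * (Num.sqrt (1 + s) * (Num.sqrt 2 * Num.sqrt (1 + m))) /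
        Num.sqrt (1 + m) ^+ 2.
      by move: (pi : R) pi0 => P P0; field; rewrite !gt_eqF.
    rewrite ler_pdivlMr ?exprn_gt0 // a2.
    apply: le_trans (g_ratio _ _ m1 (ltW ms) s2) _.
    by rewrite -[X in _ * X <= _]q2 expr2 ler_wpM2l // ler_wpM2l // ltW.
apply: le_trans VG _.
have c0 : 0 <= Num.sqrt (1 - t) by rewrite sqrtr_ge0.
have c2 : Num.sqrt (1 - t) ^+ 2 = 1 - t by rewrite sqr_sqrtr; lra.
rewrite weighted_arcsineE //.
have cb : Num.sqrt (1 - t) <= Num.sqrt (1 - m) by rewrite ler_sqrt; lra.
have -> : t - m = Num.sqrt (1 - m) ^+ 2 - Num.sqrt (1 - t) ^+ 2.
  by rewrite b2 c2; ring.
have D0 : 0 <= (Num.sqrt (1 - m) - Num.sqrt (1 - t)) * Num.sqrt (1 - t).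
  by rewrite mulr_ge0 ?subr_ge0.
(* With [b = sqrt (1 - m)] and [c = sqrt (1 - t)], the sides are [2 * A * (b - c) * (b + c) / b] and
   [2 * A * (b - c)]; they differ by [2 * A * (b - c) * c / b]. *)
rewrite -subr_ge0 [X in 0 <= X](_ : _ = 2 * A *
  ((Num.sqrt (1 - m) - Num.sqrt (1 - t)) * Num.sqrt (1 - t)) /
  Num.sqrt (1 - m)).
  exact: divr_ge0 (mulr_ge0 (mulr_ge0 (ler0n _ 2) A0) D0) (ltW b0).
by rewrite /G /A; move: (pi : R) pi0 => P P0; field; rewrite !gt_eqF.
Qed.

(** To the left of [m] one has [g s <= g m] and [1 - s >= 1 - m], so only [1 / sqrt (1 + s)] remains
    to be integrated, without a factor [sqrt 2]. *)
Lemma integral_weighted_arcsine_upper_left (m x : R) :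
  m < 1 -> x <= m -> -1 <= x ->
  V m - V x <= 2 * ((m - x) * f m).
Proof.
move=> m2 xm x1.
have [->|m_neqx] := eqVneq m x; first by rewrite !subrr mul0r mulr0.
have m1 : -1 < m by rewrite (le_lt_trans x1) // lt_neqAle eq_sym m_neqx.
have pi0 : 0 < pi :> R := pi_gt0 R.
have gm0 := g_ge0 _ m1 m2.
have a0 : 0 < Num.sqrt (1 + m) by rewrite sqrtr_gt0; lra.
have b0 : 0 < Num.sqrt (1 - m) by rewrite sqrtr_gt0; lra.
have a2 : Num.sqrt (1 + m) ^+ 2 = 1 + m by rewrite sqr_sqrtr; lra.
pose A := g m / (pi * Num.sqrt (1 - m)).
have A0 : 0 <= A by rewrite divr_ge0 ?mulr_ge0 ?sqrtr_ge0 ?pi_ge0.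
pose G (s : R) := (2 * A) * Num.sqrt (1 + s).
have VG : V m - V x <= G m - G x.
  apply: (@increment_le _ V G f (fun s => A / Num.sqrt (1 + s)) x m xm).
  - apply: integral_weighted_arcsine_continuous => //; exact: ltW.
  - apply: continuous_subspaceT => s; apply: cvgMr.
    apply: continuous_comp; last exact: sqrt_continuous.
    by apply: cvgD; [exact: cvg_cst|exact: cvg_id].
  - move=> s xs sm; have s1 : -1 < s by lra.
    have s2 : s < 1 by lra.
    have p0 : 0 < Num.sqrt (1 - s) by rewrite sqrtr_gt0; lra.
    have q0 : 0 < Num.sqrt (1 + s) by rewrite sqrtr_gt0; lra.
    split; first exact: integral_weighted_arcsine_derive.
      have s0 : 0 < 1 + s by lra.
      have ds := is_derive1_sqrt s0.
      apply: is_derive_eq.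
      by rewrite /GRing.scale /=; field; rewrite gt_eqF.
    rewrite weighted_arcsineE // mulrA invfM [X in X <= _]mulrA.
    rewrite ler_pM2r ?invr_gt0 //.
    have gs0 := g_ge0 _ s1 s2.
    rewrite ler_pM ?invr_ge0 ?mulr_ge0 ?sqrtr_ge0 ?pi_ge0 //.
      by apply: g_incr => //; exact: ltW.
    rewrite lef_pV2 ?posrE ?mulr_gt0 // ler_pM2l // ler_sqrt; lra.
apply: le_trans VG _.
have c0 : 0 <= Num.sqrt (1 + x) by rewrite sqrtr_ge0.
have c2 : Num.sqrt (1 + x) ^+ 2 = 1 + x by rewrite sqr_sqrtr; lra.
rewrite weighted_arcsineE //.
have ca : Num.sqrt (1 + x) <= Num.sqrt (1 + m) by rewrite ler_sqrt; lra.
have -> : m - x = Num.sqrt (1 + m) ^+ 2 - Num.sqrt (1 + x) ^+ 2.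
  by rewrite a2 c2; ring.
have D0 : 0 <= (Num.sqrt (1 + m) - Num.sqrt (1 + x)) * Num.sqrt (1 + x).
  by rewrite mulr_ge0 ?subr_ge0.
rewrite -subr_ge0 [X in 0 <= X](_ : _ = 2 * A *
  ((Num.sqrt (1 + m) - Num.sqrt (1 + x)) * Num.sqrt (1 + x)) /
  Num.sqrt (1 + m)).
  exact: divr_ge0 (mulr_ge0 (mulr_ge0 (ler0n _ 2) A0) D0) (ltW a0).
by rewrite /G /A; move: (pi : R) pi0 => P P0; field; rewrite !gt_eqF.
Qed.

(** On []m, t[], [g s >= g m], while [1 - s <= 1 - m] and [1 + s <= 2 * (1 + m)] give
    [1 - s ^+ 2 <= 2 * (1 - m ^+ 2)]. *)
Lemma integral_weighted_arcsine_lower_right (m t : R) :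
  -1 < m -> m <= t -> t <= 1 -> t - m <= 1 + m ->
  (t - m) * f m <= Num.sqrt 2 * (V t - V m).
Proof.
move=> m1 mt t1 tm.
have [->|t_neqm] := eqVneq t m; first by rewrite !subrr mul0r mulr0.
have m2 : m < 1 by rewrite (lt_le_trans _ t1) // lt_neqAle eq_sym t_neqm.
have pi0 : 0 < pi :> R := pi_gt0 R.
have gm0 := g_ge0 _ m1 m2.
rewrite -ler_pdivrMl ?sqrtr_gt0 //.
pose A := (Num.sqrt 2)^-1 * f m.
pose G (s : R) := A * s.
suff : G t - G m <= V t - V m by rewrite /G /A; lra.
apply: (@increment_le _ G V (fun=> A) f m t mt).
- apply: continuous_subspaceT => s; apply: cvgMr; exact: cvg_id.
- apply: integral_weighted_arcsine_continuous => //; exact: ltW.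
- move=> s ms st; have s1 : -1 < s by lra.
  have s2 : s < 1 by lra.
  split; last 1 first.
  + rewrite /A /f /weighted_arcsine mulrCA -invfM.
    have w0 (u : R) : -1 < u -> u < 1 -> 0 < Num.sqrt (1 - u ^+ 2).
      by move=> ? ?; rewrite sqrtr_gt0; nra.
    rewrite ler_pM ?invr_ge0 ?mulr_ge0 ?sqrtr_ge0 ?pi_ge0 //.
      by apply: g_incr => //; exact: ltW.
    rewrite lef_pV2 ?posrE ?mulr_gt0 ?sqrtr_gt0 ?w0 //; try by nra.
    rewrite mulrCA ler_pM2l // -sqrtrM // ler_sqrt; nra.
  + apply: is_derive_eq.
    by rewrite /GRing.scale /= mulr1.
  + exact: integral_weighted_arcsine_derive.
Qed.

Lemma integral_weighted_arcsine_nondecreasing (x y : R) :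
  -1 <= x -> x <= y -> y <= 1 -> V x <= V y.
Proof.
move=> x1 xy y1; rewrite -subr_ge0 -(subrr (cst 0 x : R)).
apply: (@increment_le _ (cst 0) V (cst 0) f x y xy).
- apply: continuous_subspaceT => s; exact: cvg_cst.
- exact: integral_weighted_arcsine_continuous.
- move=> s xs sy; have s1 : -1 < s by lra.
  have s2 : s < 1 by lra.
  split; [exact: is_derive_cst|exact: integral_weighted_arcsine_derive|].
  by apply: weighted_arcsine_ge0; exact: ltW.
Qed.

Lemma integral_weighted_arcsine_midpoint (x t : R) :
  -1 <= x -> x < t -> t <= 1 ->
  (t - x) * (1 / 4 * f ((t + x) / 2)) <= V t - V x
    <= (t - x) * (pi * Num.sqrt 2 * f ((t + x) / 2)).
Proof.
move=> x1 xt t1; set m := (t + x) / 2.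
have [m1 m2] : -1 < m /\ m < 1 by rewrite /m; lra.
have [mt xm] : m <= t /\ x <= m by rewrite /m; lra.
have fm0 : 0 <= f m by apply: weighted_arcsine_ge0; exact: ltW.
(* Because [t - m = m - x] and [-1 <= x]. *)
have tm : t - m <= 1 + m by rewrite /m; lra.
have htm : t - m = (t - x) / 2 by rewrite /m; lra.
have hmx : m - x = (t - x) / 2 by rewrite /m; lra.
have := integral_weighted_arcsine_upper_right _ _ m1 mt t1 tm.
have := integral_weighted_arcsine_lower_right _ _ m1 mt t1 tm.
have := integral_weighted_arcsine_upper_left _ _ m2 xm x1.
have := integral_weighted_arcsine_nondecreasing _ _ x1 xm (ltW m2).
rewrite htm hmx => Vxm ul lr ur.
have F0 : 0 <= (t - x) * f m by rewrite mulr_ge0 // subr_ge0 ltW.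
have r2 : (Num.sqrt 2 : R) ^+ 2 = 2 by rewrite sqr_sqrtr.
have r0 : 0 <= Num.sqrt 2 :> R by rewrite sqrtr_ge0.
(* [sqrt 2 <= 2] turns the lower constant [1 / (2 * sqrt 2)] into [1 / 4]; [1 <= sqrt 2] turns the
   upper one, [1 + sqrt 2], into [2 * sqrt 2]. *)
have [r1 r3] : 1 <= Num.sqrt 2 :> R /\ Num.sqrt 2 <= 2 :> R by split; nra.
have pi2 : 2 <= pi :> R by exact: pi_ge2.
apply/andP; split; first nra.
have : 2 * Num.sqrt 2 <= pi * Num.sqrt 2 :> R by rewrite ler_wpM2r.
nra.
Qed.

End Weighted.

(** * Transfer from [V] to [W] *)

Lemma W_density (R : realType) (k : nat)
    (mu : probability (measurableTypeR R) R) (f : R -> R) (s : R) :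
  has_density_on mu `[-1, 1] f -> s <= 1 ->
  W k mu s = k%:R * \int[@lebesgue_measure R]_(t in `[-1, s]) f t.
Proof.
move=> hdens s1; rewrite /W Rintegral_cst // mul1r; congr (_ * fine _).
apply: hdens => //.
by apply: subset_itvl; rewrite bnd_simp.
Qed.


Theorem theorem2p6 (R : realType) (k : nat) (hk : (2 <= k)%N)
    (mu : probability (measurableTypeR R) R) (g : R -> R)
    (hmu : concentrated_on mu `[-1, 1])
    (hdens : has_density_on mu `[-1, 1] (weighted_arcsine g))
    (hg_ge0 : {in `]-1, 1[, forall t : R, 0 <= g t})
    (hg_concave : concave_function `]-1, 1[ g)
    (hg_incr : {in `]-1, 1[ &, nondecreasing_fun g})
    (hg_convex : @convex_function R R^o `]-1, 1[ (fun t : R => g t / (t + 1))) :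
  {in `]-1, 1[, forall t : R,
    is_derive t 1 (W k mu) (k%:R * g t / (pi * Num.sqrt (1 - t ^+ 2)))} /\
  {in `[-1, 1] &, forall x t : R, x != t ->
    (1 / 4) * (W k mu)^`()%classic ((t + x) / 2)
      <= (W k mu t - W k mu x) / (t - x)
      <= (pi * Num.sqrt 2) * (W k mu)^`()%classic ((t + x) / 2)}.
Proof.
pose f := weighted_arcsine g.
have g_ge0 (x : R) : -1 < x -> x < 1 -> 0 <= g x.
  by move=> x1 x2; apply: hg_ge0; rewrite in_itv /= x1.
have g_incr (x y : R) : -1 < x -> x <= y -> y < 1 -> g x <= g y.
  move=> x1 xy y1; apply: hg_incr => //; rewrite in_itv /=.
    by rewrite x1 (le_lt_trans xy).
  by rewrite y1 (lt_le_trans x1).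
have g_ratio (x y : R) : -1 < x -> x <= y -> y < 1 ->
    g y * (1 + x) <= g x * (1 + y).
  move=> x1 xy y1; rewrite (addrC 1 x) (addrC 1 y) -{1}(opprK 1) -{2}(opprK 1).
  exact: concave_ge0_ratio_nonincr hg_ge0 hg_concave _ _ x1 xy y1.
have f_int : (@lebesgue_measure R).-integrable `[-1, 1] (EFin \o f).
  apply: weighted_arcsine_integrable => //.
  (* The integral of the density over [[-1, 1]] is the total mass 1, hence finite. *)
  by rewrite -(hdens `[-1, 1]%classic) // hmu ltry.
pose V (x : R) := \int[@lebesgue_measure R]_(t in `[-1, x]) f t.
have WV s : s <= 1 -> W k mu s = k%:R * V s by exact: W_density.
have dW (t : R) : -1 < t -> t < 1 -> is_derive t 1 (W k mu) (k%:R * f t).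
  (* Since [t < 1], [W] and [k * V] agree on a whole neighbourhood of [t]. *)
  move=> t1 t2; apply: (@near_eq_is_derive _ _ _ (fun s => k%:R * V s)).
    near=> s; rewrite WV //; apply/ltW.
    by near: s; exact: lt_nbhsl.
  have dV := integral_weighted_arcsine_derive _ _ g_incr g_ratio f_int _ t1 t2.
  exact: is_deriveZ.
split.
  move=> t; rewrite in_itv /= => /andP[t1 t2].
  by rewrite -mulrA; exact: dW.
move=> x t; rewrite !in_itv /= => /andP[x1 x2] /andP[t1 t2].
(* The difference quotient and the midpoint are symmetric in [x] and [t]. *)
wlog xt : x t x1 x2 t1 t2 / x < t.
  move=> main; rewrite neq_lt => /orP[xt|tx].
    by apply: main => //; rewrite lt_eqF.
  rewrite (addrC t) -(opprB (W k mu x)) -(opprB x t) invrN mulrNN.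
  by apply: main => //; rewrite lt_eqF.
move=> _; set m := (t + x) / 2.
have [m1 m2] : -1 < m /\ m < 1 by rewrite /m; lra.
have dWm := dW m m1 m2.
rewrite derive1E derive_val !WV // -mulrBr.
rewrite ler_pdivlMr ?ler_pdivrMr ?subr_gt0 //.
have /andP[lo up] := integral_weighted_arcsine_midpoint
  _ _ g_ge0 g_incr g_ratio f_int _ _ x1 xt t2.
apply/andP; split.
  rewrite [leLHS](_ : _ = k%:R * ((t - x) * (1 / 4 * f m))); last by ring.
  exact: ler_wpM2l.
rewrite [leRHS](_ : _ = k%:R * ((t - x) * (pi * Num.sqrt 2 * f m))).
  exact: ler_wpM2l.
by ring.
Unshelve. all: by end_near. Qed.
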